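(* Let $n\ge1$. For every constant $\alpha>0$, the function $$p^\alpha_{\mathbb{B}^n}(x,y)=\frac{|x-y|}{\sqrt{|x-y|^2+\alpha(1-|x|)(1-|y|)}},\quad x,y\in\mathbb{B}^n,$$ is not a metric on $\mathbb{B}^n$.
   Context: $\mathbb{B}^n=\{x\in\mathbb{R}^n : |x|<1\}$ is the open unit ball, and $|\cdot|$ is the Euclidean norm on $\mathbb{R}^n$. *)

(* Defs.v *)
From mathcomp Require Import all_boot all_order all_algebra.
From mathcomp Require Import classical_sets reals.

Set Implicit Arguments.
Unset Strict Implicit.
Unset Printing Implicit Defensive.

Import Order.TTheory GRing.Theory Num.Theory.

Local Open Scope ring_scope.
Local Open Scope classical_set_scope.

(* MathComp-Analysis equips 'rV[R]_n with the sup norm, so `|x| cannot be used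
   for the Euclidean norm. *)
Definition enorm (R : realType) (n : nat) (x : 'rV[R]_n) : R :=
  Num.sqrt (\sum_(i < n) x 0 i ^+ 2).

Definition unit_ball (R : realType) (n : nat) : set 'rV[R]_n :=
  [set x | enorm x < 1].
Arguments unit_ball R n : clear implicits.

Record is_metric_on (R : realType) (T : Type) (D : set T) (d : T -> T -> R) :
    Prop := IsMetricOn {
  metric_ge0 : forall x y, D x -> D y -> 0 <= d x y;
  metric_eq0 : forall x y, D x -> D y -> (d x y = 0 <-> x = y);
  metric_sym : forall x y, D x -> D y -> d x y = d y x;
  metric_triangle : forall x y z, D x -> D y -> D z -> d x z <= d x y + d y z
}.

(* Only meaningful for x, y in the open unit ball and 0 < alpha, where the
   quantity under the square root is positive. *)
Definition p_alpha (R : realType) (n : nat) (alpha : R) (x y : 'rV[R]_n) : R :=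
  enorm (x - y) /
  Num.sqrt (enorm (x - y) ^+ 2 + alpha * (1 - enorm x) * (1 - enorm y)).

(* Main.v *)
Require Import Defs.
From mathcomp Require Import all_boot all_order all_algebra.
From mathcomp Require Import classical_sets reals.
From mathcomp Require Import ring lra.

(** The triangle inequality fails at -t, 0, t on a diameter, for small t > 0:
  writing d(-t, t) = 2t / sqrt A and d(-t, 0) = d(0, t) = t / sqrt B, it amounts
  to B <= A, that is, to alpha * (1 - t) <= 3 * t.  The choice
  t = alpha / (alpha + 4) makes alpha * (1 - t) = 4 * t, so that A = 4 * t and
  B = t ^ 2 + 4 * t. *)

Set Implicit Arguments.
Unset Strict Implicit.
Unset Printing Implicit Defensive.

Import Order.TTheory GRing.Theory Num.Theory.

Local Open Scope ring_scope.

Lemma enorm_scale_delta (R : realType) (n : nat) (i : 'I_n) (a : R) :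
  enorm (a *: delta_mx 0 i) = `|a|.
Proof.
rewrite /enorm (bigD1 i) //= big1 => [|j ji].
  by rewrite !mxE !eqxx mulr1 addr0 sqrtr_sqr.
by rewrite !mxE (negbTE ji) andbF mulr0 expr0n.
Qed.

(** Differences of points on a coordinate axis stay on it, so every norm becomes an absolute
    value. *)
Lemma p_alpha_line (R : realType) (n : nat) (i : 'I_n) (alpha a b : R) :
  p_alpha alpha (a *: delta_mx 0 i) (b *: delta_mx 0 i) =
  `|a - b| / Num.sqrt (`|a - b| ^+ 2 + alpha * (1 - `|a|) * (1 - `|b|)).
Proof. by rewrite /p_alpha -scalerBl !enorm_scale_delta. Qed.

Theorem theorem5p15 (R : realType) (n : nat) (hn : (1 <= n)%N)
    (alpha : R) (halpha : 0 < alpha) :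
  ~ is_metric_on (unit_ball R n) (@p_alpha R n alpha).
Proof.
case=> _ _ _ triangle.
(* As [1 <= n] unfolds to [0 < n], [Ordinal hn] is the first coordinate. *)
pose u (a : R) : 'rV[R]_n := a *: delta_mx 0 (Ordinal hn).
have u_ball a : `|a| < 1 -> unit_ball R n (u a).
  by rewrite /unit_ball /= enorm_scale_delta.
pose t := alpha / (alpha + 4).
have t_gt0 : 0 < t by apply: divr_gt0 => //; lra.
have t_lt1 : t < 1 by rewrite ltr_pdivrMr; lra.
have alpha_t : alpha * (1 - t) = 4 * t by rewrite /t; field; lra.
have normt : `|t| = t by rewrite gtr0_norm.
have := triangle (u (- t)) (u 0) (u t).
rewrite !p_alpha_line sub0r !subr0 !normrN normr0 normt !subr0 !mulr1.
have -> : `|- t - t| = 2 * t by rewrite -opprD normrN gtr0_norm; lra.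
rewrite alpha_t.
have -> : (2 * t) ^+ 2 + 4 * t * (1 - t) = 4 * t by ring.
move=> le_d.
(* Both terms on the right equal t / sqrt B, so they add up to 2t / sqrt B. *)
have {le_d}: 2 * t / Num.sqrt (4 * t) <= 2 * t / Num.sqrt (t ^+ 2 + 4 * t).
  apply: le_trans (le_d _ _ _) _;
    try by apply: u_ball; rewrite ?normrN ?normr0 ?normt.
  by rewrite -mulrDl; lra.
have t2_gt0 : 0 < t ^+ 2 by rewrite exprn_gt0.
(* Cancelling 2t, the inverses and the roots leaves B <= A, that is t ^ 2 <= 0. *)
rewrite ler_pM2l ?lef_pV2 ?posrE ?sqrtr_gt0 ?ler_sqrt; lra.
Qed.
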